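(* Let $\mathbb{H}$ be the half-plane one-way lattice: set $\epsilon_y=1$ for $y\ge 0$ and $\epsilon_y=-1$ for $y<0$ ($y\in\mathbb{Z}$), and let $\mathbb{H}$ be the directed graph with vertex set $\mathbb{Z}^2$ in which $(\mathbf{u},\mathbf{v})$ is a directed edge from $\mathbf{u}=(u_1,u_2)$ to $\mathbf{v}=(v_1,v_2)$ if and only if either $v_1=u_1$ and $v_2=u_2\pm 1$, or $v_2=u_2$ and $v_1=u_1+\epsilon_{u_2}$. Then the simple random walk on $\mathbb{H}$ is transient.
   Context: The simple random walk on a directed graph with vertex set $\mathbb{V}$ and edge set $\mathbb{A}\subseteq \mathbb{V}\times\mathbb{V}$ (no loops, no multiple edges, finite out-degrees) is the $\mathbb{V}$-valued Markov chain $(\mathbf{M}_n)_{n\in\mathbb{N}}$ with transition probabilities $P_{\mathbf{u},\mathbf{v}}=\mathbb{P}(\mathbf{M}_{n+1}=\mathbf{v}\mid \mathbf{M}_n=\mathbf{u})=1/d^-_{\mathbf{u}}$ if $(\mathbf{u},\mathbf{v})\in\mathbb{A}$ and $0$ otherwise, where $d^-_{\mathbf{u}}=\mathrm{card}\{\mathbf{v}:(\mathbf{u},\mathbf{v})\in\mathbb{A}\}$ is the out-degree of $\mathbf{u}$. In the lattice considered here $d^-_{\mathbf{u}}=3$ for every $\mathbf{u}$. Transient is meant in the usual sense for Markov chains: started from any vertex, the probability that the chain ever returns to that vertex is strictly less than $1$. *)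

(* Defs.v *)
From HB Require Import structures.
From mathcomp Require Import all_boot all_order all_algebra finmap.
From mathcomp Require Import all_classical all_reals all_analysis.
From mathcomp Require Import zify.

Set Implicit Arguments.
Unset Strict Implicit.
Unset Printing Implicit Defensive.

Import Order.TTheory GRing.Theory Num.Theory.
Local Open Scope classical_set_scope.
Local Open Scope ring_scope.

(* Arcs form a relation, so there are no multiple edges. *)
Record digraph (V : countType) := Digraph {
  arc : rel V ;
  arc_irr : irreflexive arc ;
  arc_fin : forall u, finite_set [set v | arc u v] }.

Definition outdeg (V : countType) (G : digraph V) (u : V) : nat :=
  #|` fset_set [set v | arc G u v]|%fset.

Definition srw_kernel (R : realType) (V : countType) (G : digraph V)
    (u v : V) : R :=
  if arc G u v then (outdeg G u)%:R^-1 else 0.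

(* Meaningful only when [P B] is nonzero. *)
Definition cond_prob (R : realType) (d : measure_display)
    (T : measurableType d) (P : probability T R) (A B : set T) : R :=
  fine (P (A `&` B)) / fine (P B).

Definition history (V T : Type) (M : nat -> T -> V) (n : nat) (x : nat -> V) :
    set T :=
  [set w | forall i, (i <= n)%N -> M i w = x i].

(* The countable state space [V] carries the discrete sigma-algebra. *)
Definition markov_chain (R : realType) (V : countType) (p : V -> V -> R)
    (d : measure_display) (T : measurableType d) (P : probability T R)
    (M : nat -> T -> V) : Prop :=
  (forall n (B : set V), measurable (M n @^-1` B)) /\
  (forall n (x : nat -> V) (v : V), (0 < P (history M n x))%E ->
     cond_prob P (M n.+1 @^-1` [set v]) (history M n x) = p (x n) v).

Definition returns (V T : Type) (M : nat -> T -> V) (u : V) : set T :=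
  [set w | exists2 n, (0 < n)%N & M n w = u].

(* The law of a chain is determined by its transition probabilities and its
   initial state, so all realizations, on all probability spaces, give the same
   return probability; hence the quantification over realizations. *)
Definition transient (R : realType) (V : countType) (p : V -> V -> R) : Prop :=
  forall (u : V) (d : measure_display) (T : measurableType d)
         (P : probability T R) (M : nat -> T -> V),
    markov_chain p P M -> P (M 0%N @^-1` [set u]) = 1%E ->
    (P (returns M u) < 1)%E.

Definition eps (y : int) : int := if 0 <= y then 1 else -1.

Definition half_plane_arc : rel (int * int) := fun u v =>
  (v.1 == u.1) && ((v.2 == u.2 + 1) || (v.2 == u.2 - 1))
  || (v.2 == u.2) && (v.1 == u.1 + eps u.2).

Lemma half_plane_arc_irr : irreflexive half_plane_arc.
Proof. by case=> a b; rewrite /half_plane_arc /eps /=; case: ifP; lia. Qed.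

Lemma half_plane_arcE (u : int * int) :
  [set v | half_plane_arc u v] =
  [set` [fset (u.1, u.2 + 1)%R; (u.1, u.2 - 1)%R; (u.1 + eps u.2, u.2)%R]%fset].
Proof.
apply/seteqP; split => -[a b] /=; rewrite /half_plane_arc !inE /= !xpair_eqE;
  by case: eqP; case: eqP; case: eqP; case: eqP; case: eqP.
Qed.

Lemma half_plane_arc_fin u : finite_set [set v | half_plane_arc u v].
Proof. by rewrite half_plane_arcE; exact: finite_fset. Qed.

Definition half_plane : digraph (int * int)%type :=
  Digraph half_plane_arc_irr half_plane_arc_fin.

Lemma outdeg_half_plane u : outdeg half_plane u = 3%N.
Proof.
rewrite /outdeg /= half_plane_arcE set_fsetK.
rewrite -fsetUA !cardfsU1 cardfs1 !inE !xpair_eqE /eps.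
by case: ifP; lia.
Qed.

(* Main.v *)
From mathcomp Require Import all_boot all_order all_algebra finmap.
From mathcomp Require Import all_classical all_reals all_analysis.
From mathcomp Require Import zify ring lra.
Require Import Defs.

(* It suffices to bound the expected number of visits to each vertex, and only
   for vertices on the axis, since the bound passes to predecessors.  Between
   crossings of the axis the walk drifts in one direction, and the displacement
   accumulated during the passages downwards across [n] levels has law
   [a n k = P (k horizontal steps before descending n levels)]; the passages
   upwards contribute an independent opposite displacement of the same kind.
   The expected number of returns is therefore essentially
   [sum_(n, k) a n k ^ 2].  In [k], seen as time, [a] solves a discrete heat
   equation on the half-line [n], with Dirichlet condition at [0].  As the Green
   kernel of the Dirichlet Laplacian is [min n m], the energy
   [Q k = <a k, Lap^-1 (a k)> = sum_(j >= 1) (sum_(n >= j) a n k) ^ 2] satisfies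
   [Q k + 2 * sum_n a n k ^ 2 <= Q (k - 1)], and the double sum is finite.
   All quantities are truncated at a time [N] and bounded uniformly in [N]. *)

Set Implicit Arguments.
Unset Strict Implicit.
Unset Printing Implicit Defensive.

Import Order.TTheory GRing.Theory Num.Theory.
Local Open Scope classical_set_scope.
Local Open Scope ring_scope.

(** * First passages of the vertical component, with their horizontal displacement *)

Section Passage.
Variable R : realFieldType.

(* The probability that the vertical component of the walk, started at height
   [n], reaches height [0] within [N] steps and after exactly [z] horizontal
   steps. *)
Fixpoint passage (N n : nat) (z : int) : R :=
  match n, N with
  | 0%N, _ => (z == 0)%:R
  | _.+1, 0%N => 0
  | n'.+1, N'.+1 =>
      (passage N' n' z + passage N' n'.+2 z + passage N' n (z - 1)) / 3
  end.

Arguments passage : simpl never.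

Lemma passage0 N z : passage N 0 z = (z == 0)%:R.
Proof. by case: N. Qed.

Lemma passageSS N n z : passage N.+1 n.+1 z =
  (passage N n z + passage N n.+2 z + passage N n.+1 (z - 1)) / 3.
Proof. by []. Qed.

Lemma passage_ge0 N n z : 0 <= passage N n z.
Proof.
elim: N n z => [|N IH] [|n] z; rewrite ?passage0 ?ler0n // passageSS.
by rewrite divr_ge0 ?addr_ge0.
Qed.

Lemma passage_leS N n z : passage N n z <= passage N.+1 n z.
Proof.
elim: N n z => [|N IH] [|n] z; rewrite ?passage0 ?passage_ge0 //.
by rewrite passageSS (passageSS N.+1) ler_pM2r ?invr_gt0// !lerD.
Qed.

Lemma passage_leD N i n z : passage N n z <= passage (N + i) n z.
Proof.
elim: i => [|i IH]; first by rewrite addn0.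
by rewrite addnS (le_trans IH) ?passage_leS.
Qed.

Lemma passage_lt0 N n z : z < 0 -> passage N n z = 0.
Proof.
elim: N n z => [|N IH] [|n] z z0 //; rewrite ?passage0 ?lt_eqF //.
by rewrite passageSS !IH ?addr0 ?mul0r//; lia.
Qed.

Lemma passage_far N n z : (N < n)%N -> passage N n z = 0.
Proof.
elim: N n z => [|N IH] [|n] z //; rewrite ltnS => Nn.
by rewrite passageSS !IH ?addr0 ?mul0r//; lia.
Qed.

(** The first-step recursion at a single truncation time, by monotonicity in [N]: with [z] as time,
    [passage N] is a subsolution of the discrete heat equation on the levels. *)
Lemma passage_sub N n z : 3 * passage N n.+1 z <=
  passage N n z + passage N n.+2 z + passage N n.+1 (z - 1).
Proof.
have := passage_leS N n.+1 z; rewrite passageSS ler_pdivlMr //; lra.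
Qed.

(** * The energy inequality for the inverse Dirichlet Laplacian *)

Section Energy.
Variables (a a' : nat -> R) (B : nat).
Hypotheses (a_ge0 : forall n, 0 <= a n) (aB : a B = 0).
Hypothesis a_sub : forall n, 3 * a n.+1 <= a n + a n.+2 + a' n.+1.

Let tail (f : nat -> R) j := \sum_(j <= n < B) f n.

Let tailE f j : (j < B)%N -> tail f j = f j + tail f j.+1.
Proof. by move=> jB; rewrite /tail big_ltn. Qed.

Let tail_B f : tail f B = 0.
Proof. by rewrite /tail big_geq. Qed.

(** Sum [a_sub] over the levels from [j.+1] to [B.-1]: the second differences telescope, and [aB]
    disposes of the top boundary term. *)
Let tail_sub i j : (i + j.+1)%N = B ->
  tail a j.+1 + a j.+1 - a j <= tail a' j.+1.
Proof.
elim: i j => [|i IH] j ijB.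
  by rewrite -[j.+1]add0n ijB !tail_B aB; have := a_ge0 j; lra.
have jB : (j.+1 < B)%N by lia.
rewrite (tailE a) // (tailE a') //.
have := IH j.+1; rewrite addnS -addSn => /(_ ijB).
have := a_sub j; lra.
Qed.

Let tail_ge0 j : 0 <= tail a j.
Proof. by rewrite sumr_ge0. Qed.

(* Multiply [tail_sub] by [tail a] and sum by parts. *)
Lemma energy :
  \sum_(1 <= j < B) a j ^+ 2 + (\sum_(1 <= j < B) tail a j ^+ 2) / 2
    <= (\sum_(1 <= j < B) tail a' j ^+ 2) / 2 + a 0%N * tail a 1.
Proof.
have [B0|B0] := leqP B 1.
  by rewrite !big_geq // /tail !big_geq//; lra.
(* Boundary terms of the summation by parts: [t B = 0] and [- t 1] is the source term. *)
pose t j := - (tail a j * a j.-1).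
have -> : a 0%N * tail a 1 = \sum_(1 <= j < B) (t j.+1 - t j).
  rewrite telescope_sumr ?(ltnW B0)// /t tail_B /=; lra.
rewrite !mulr_suml -!big_split /= ler_sum_nat // => -[//|j] /andP[_ jB].
rewrite /t /=.
have /= h := @tail_sub (B - j.+1) j; have := h ltac:(lia) => {h}.
have := tailE a jB; have := tail_ge0 j.+1.
move: (tail a j.+1) (tail a' j.+1) (tail a j.+2) => b b' c b0 bE.
(* Young's inequality [b * b' <= (b ^+ 2 + b' ^+ 2) / 2] leaves half of each energy. *)
move=> /(ler_wpM2l b0); have := sqr_ge0 (b - b').
have -> : c = b - a j.+1 by lra.
rewrite !expr2; lra.
Qed.
End Energy.

(** The energy [Q]; levels above [N] are out of reach within [N] steps and contribute nothing. *)
Definition energyQ N z : R :=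
  \sum_(1 <= j < N.+1) (\sum_(j <= n < N.+1) passage N n z) ^+ 2.

Lemma passage_energy N z :
  \sum_(1 <= n < N.+1) passage N n z ^+ 2 + energyQ N z / 2
    <= energyQ N (z - 1) / 2
       + (z == 0)%:R * \sum_(1 <= n < N.+1) passage N n z.
Proof.
have := @energy (passage N ^~ z) (passage N ^~ (z - 1)) N.+1.
rewrite passage0; apply => [n||n]; first exact: passage_ge0.
  by rewrite passage_far.
exact: passage_sub.
Qed.

Lemma energyQ_ge0 N z : 0 <= energyQ N z.
Proof. by apply: sumr_ge0 => j _; exact: sqr_ge0. Qed.

(** At [z = 0] no energy is inherited, and the term [j = 1] of [energyQ] is the square of the sum
    [s]; hence [s ^+ 2 / 2 <= s]. *)
Lemma passage_sum_le2 N : \sum_(1 <= n < N.+1) passage N n 0 <= 2.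
Proof.
have [->|N0] := posnP N; first by rewrite big_geq.
have := passage_energy N 0.
rewrite eqxx mul1r sub0r.
have -> : energyQ N (-1) = 0.
  rewrite /energyQ big1 // => j _.
  by rewrite big1 ?expr0n// => n _; rewrite passage_lt0.
have : (\sum_(1 <= n < N.+1) passage N n 0) ^+ 2 <= energyQ N 0.
  rewrite /energyQ [leRHS]big_ltn // lerDl.
  by apply: sumr_ge0 => j _; exact: sqr_ge0.
have : 0 <= \sum_(1 <= n < N.+1) passage N n 0 ^+ 2.
  by apply: sumr_ge0 => j _; exact: sqr_ge0.
move: (\sum_(1 <= n < N.+1) passage N n 0) => s; nra.
Qed.

Lemma passage_sqr_le3 N K :
  \sum_(k < K) \sum_(n < N.+1) passage N n k%:Z ^+ 2 <= 3.
Proof.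
(* The energies telescope in [k]. The only source is at [k = 0]: [1] from level [0] and at most [2]
   from [passage_sum_le2]. The factor [K != 0] starts the induction at the empty sum. *)
suff : \sum_(k < K) (\sum_(n < N.+1) passage N n k%:Z ^+ 2)
  + energyQ N (K%:Z - 1) / 2 <= (K != 0%N)%:R * 3.
  have := energyQ_ge0 N (K%:Z - 1); case: (K != _); rewrite ?mul0r ?mul1r; lra.
elim: K => [|K IH].
  rewrite big_ord0 add0r mul0r /energyQ big1 ?mul0r // => j _.
  by rewrite big1 ?expr0n// => n _; rewrite passage_lt0.
rewrite big_ord_recr /= mul1r.
rewrite -(big_mkord xpredT (fun n => passage N n K%:Z ^+ 2)).
rewrite big_ltn // passage0.
have := passage_energy N K.
have -> : K.+1%:Z - 1 = K by lia.
case: K IH => [|K]; last first.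
  by rewrite /= !mul0r expr0n /=; lra.
have := passage_sum_le2 N; rewrite eqxx /= mul0r mul1r expr1n big_ord0; lra.
Qed.

(** * Shifted sums and the truncated Green function *)

Lemma sum_shift_nat (g : nat -> R) (s M : nat) : (forall k, 0 <= g k) ->
  \sum_(k < M) g (k + s)%N <= \sum_(k < M + s) g k.
Proof.
move=> g0; rewrite -(big_mkord xpredT g).
rewrite -(big_mkord xpredT (fun k => g (k + s)%N)).
rewrite (@big_cat_nat _ _ _ s 0 (M + s)) //=; last by rewrite leq_addl.
by rewrite -{3}(add0n s) big_addn addnK lerDr sumr_ge0.
Qed.

Lemma sum_shift_int (g : int -> R) (x : int) (M : nat) :
  (forall z, 0 <= g z) -> (forall z, z < 0 -> g z = 0) ->
  \sum_(k < M) g (k%:Z + x) <= \sum_(k < M + `|x|) g k%:Z.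
Proof.
move=> g0 gN; case: x => [s|s].
  exact: (@sum_shift_nat (fun k => g k%:Z)).
apply: (@le_trans _ _ (\sum_(k < M) g k%:Z)); last first.
  by rewrite big_split_ord /= lerDl sumr_ge0.
rewrite NegzE; elim: s.+1 g g0 gN => {s} [|s IH] g g0 gN.
  by under eq_bigr do rewrite subr0.
have -> : \sum_(k < M) g (k%:Z - s.+1%:Z) = \sum_(k < M) g (k%:Z - s%:Z - 1).
  by apply: eq_bigr => k _; congr g; lia.
apply: le_trans (IH (fun z => g (z - 1)) _ _) _ => [//|z z0|].
  by apply: gN; lia.
case: M {IH} => [|M]; first by rewrite !big_ord0.
rewrite big_ord_recl gN // add0r [leRHS]big_ord_recr /=.
rewrite ler_wpDr //; apply: ler_sum => k _.
by rewrite /bump add1n (_ : k.+1%:Z - 1 = k%:Z) //; lia.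
Qed.

Let dsum N (f : nat -> nat -> R) := \sum_(m < N) \sum_(k < N) f m k.

Let le_dsum N f g : (forall m k, f m k <= g m k) -> dsum N f <= dsum N g.
Proof. by move=> fg; apply: ler_sum => m _; exact: ler_sum. Qed.

Let dsumD N f g : dsum N (fun m k => f m k + g m k) = dsum N f + dsum N g.
Proof. by rewrite -big_split; apply: eq_bigr => m _; rewrite big_split. Qed.

Let dsumZ N f c : dsum N (fun m k => f m k * c) = dsum N f * c.
Proof. by rewrite mulr_suml; apply: eq_bigr => m _; rewrite mulr_suml. Qed.

Let dsum_leS N f : (forall m k, 0 <= f m k) -> dsum N f <= dsum N.+1 f.
Proof.
move=> f0; rewrite /dsum big_ord_recr ler_wpDr ?sumr_ge0 //=.
by apply: ler_sum => m _; rewrite big_ord_recr ler_wpDr.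
Qed.

Let dsum_col N f : (forall m k, 0 <= f m k) ->
  dsum N (fun m k => f m k.+1) <= dsum N.+1 f.
Proof.
move=> f0; rewrite /dsum big_ord_recr ler_wpDr ?sumr_ge0 //=.
by apply: ler_sum => m _; rewrite big_ord_recl ler_wpDl.
Qed.

Let dsum_row N f : (forall m k, 0 <= f m k) ->
  dsum N (fun m k => f m.+1 k) + f 0%N 0%N <= dsum N.+1 f.
Proof.
move=> f0; rewrite /dsum big_ord_recl addrC lerD //=.
  by rewrite big_ord_recl lerDl sumr_ge0.
by apply: ler_sum => m _; rewrite big_ord_recr ler_wpDr.
Qed.

(* A third of the Green function with pole [(0, 0)], truncated at time [N]: the
   walk alternates between first passages from the upper to the lower
   half-plane, which move it right, and back, which move it left; [passage]
   gives the laws of the total displacements in the two directions. *)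
Definition green (N : nat) (v : int * int) : R :=
  match v.2 with
  | Posz y => dsum N (fun m k =>
                passage N (m + y).+1 k%:Z * passage N m (k%:Z + v.1))
  | Negz j => dsum N (fun m k =>
                passage N m.+1 k%:Z * passage N (m + j).+1 (k%:Z + v.1))
  end.

Lemma green_ge0 N v : 0 <= green N v.
Proof.
by rewrite /green /dsum; case: v.2 => y; apply: sumr_ge0 => m _;
  apply: sumr_ge0 => k _; rewrite mulr_ge0 ?passage_ge0.
Qed.

Let passage_mul_ge0 N N' n n' z z' : 0 <= passage N n z * passage N' n' z'.
Proof. by rewrite mulr_ge0 ?passage_ge0. Qed.

(** First-step expansion of the downward factor in [green N.+1] produces the three neighbours; the
    other factor only grows with [N]. *)
Lemma green_up N x (y : nat) :
  (green N (x, y%:Z + 1) + green N (x, y%:Z - 1) + green N (x + 1, y%:Z)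
   + ((x, y%:Z) == (0, 0))%:R) / 3 <= green N.+1 (x, y%:Z).
Proof.
(* [i] is [2], [0] or [1] after a step up, down or sideways; [j] counts the horizontal step. *)
pose f i j m k := passage N (m + y + i) (k%:Z - j%:Z) * passage N m (k%:Z + x).
have f0 i j m k : 0 <= f i j m k by exact: passage_mul_ge0.
rewrite {4}/green /=.
apply: (@le_trans _ _ (dsum N.+1 (fun m k =>
  (f 2 0%N m k + f 0%N 0%N m k + f 1%N 1%N m k) / 3))); last first.
  apply: le_dsum => m k; rewrite passageSS /f !addn0 addn1 addn2 subr0.
  rewrite -!mulrDl mulrAC (addrC (passage _ _.+2 _)).
  by rewrite ler_pM ?passage_leS ?divr_ge0 ?addr_ge0 ?passage_ge0.
rewrite dsumZ !dsumD ler_pM2r ?invr_gt0 //.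
rewrite -!addrA (addrC (green N (x + 1, _))) !addrA -(addrA (green _ _)).
rewrite !lerD //.
- rewrite (_ : y%:Z + 1 = y.+1) /green /=; last lia.
  apply: le_trans (dsum_leS _ (f0 _ _)); apply: le_dsum => m k.
  by rewrite /f subr0 addn2 addnS.
- case: y @f f0 => [|y] f f0.
    (* From height [0] a step down shifts [m]: the rows [m >= 1] give height [-1], and the corner
       [m = k = 0] gives the source. *)
    apply: le_trans (dsum_row _ (f0 _ _)); rewrite lerD //.
      by apply: le_dsum => m k; rewrite /f /= subr0 !addn0.
    rewrite /f !addn0 !passage0 subr0 eqxx mul1r add0r xpair_eqE.
    by rewrite eqxx andbT lexx.
  rewrite xpair_eqE andbF addr0 (_ : y.+1%:Z - 1 = y) /green /=; last lia.
  apply: le_trans (dsum_leS _ (f0 _ _)); apply: le_dsum => m k.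
  by rewrite /f subr0 addn0 addnS.
- apply: le_trans (dsum_col _ (f0 _ _)); apply: le_dsum => m k.
  have kE : k.+1%:Z - 1%:Z = k by lia.
  have kxE : k.+1%:Z + x = k%:Z + (x + 1) by lia.
  by rewrite /f addn1 kE kxE.
Qed.

(** Now the upward factor is expanded. At [j = 0] a step up gives the formula for height [0]
    exactly, so no source appears. *)
Lemma green_down N x (j : nat) :
  (green N (x, Negz j + 1) + green N (x, Negz j - 1) + green N (x - 1, Negz j))
   / 3 <= green N.+1 (x, Negz j).
Proof.
pose f i l m k := passage N m.+1 k%:Z * passage N (m + j + i) (k%:Z + x - l%:Z).
have f0 i l m k : 0 <= f i l m k by exact: passage_mul_ge0.
rewrite {4}/green /=.
apply: (@le_trans _ _ (dsum N.+1 (fun m k =>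
  (f 0%N 0%N m k + f 2 0%N m k + f 1%N 1%N m k) / 3))); last first.
  apply: le_dsum => m k; rewrite (passageSS _ (m + j)).
  rewrite /f !addn0 addn1 addn2 subr0 -!mulrDr -mulrA.
  by rewrite ler_pM ?passage_leS ?divr_ge0 ?addr_ge0 ?passage_ge0.
rewrite dsumZ !dsumD ler_pM2r ?invr_gt0 // !lerD //.
- apply: le_trans (dsum_leS _ (f0 _ _)).
  case: j @f f0 => [|j] f f0.
    by apply: le_dsum => m k; rewrite /f /= subr0 !addn0.
  rewrite (_ : Negz j.+1 + 1 = Negz j) /green /=; last lia.
  by apply: le_dsum => m k; rewrite /f subr0 addn0 addnS.
- rewrite (_ : Negz j - 1 = Negz j.+1) /green /=; last lia.
  apply: le_trans (dsum_leS _ (f0 _ _)); apply: le_dsum => m k.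
  by rewrite /f subr0 addn2 addnS.
- apply: le_trans (dsum_leS _ (f0 _ _)); apply: le_dsum => m k.
  by rewrite /f addn1 addrA.
Qed.

Let dsum_passage_sqr_le3 N (y : nat) (x : int) :
  dsum N (fun m k => passage N (m + y) (k%:Z + x) ^+ 2) <= 3.
Proof.
rewrite /dsum exchange_big /=.
apply: le_trans (passage_sqr_le3 (N + y) (N + `|x|)).
pose g z := \sum_(n < (N + y).+1) passage (N + y) n z ^+ 2.
apply: (@le_trans _ _ (\sum_(k < N) g (k%:Z + x))).
  apply: ler_sum => k _; rewrite /g big_ord_recr ler_wpDr ?sqr_ge0 //=.
  apply: (@le_trans _ _ (\sum_(m < N) passage (N + y) (m + y) (k%:Z + x) ^+ 2)).
    apply: ler_sum => m _; rewrite lerXn2r ?nnegrE ?passage_ge0 //.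
    exact: passage_leD.
  pose gk n := passage (N + y) n (k%:Z + x) ^+ 2.
  by apply: (@sum_shift_nat gk) => n; exact: sqr_ge0.
apply: sum_shift_int => [z|z z0].
  by apply: sumr_ge0 => n _; exact: sqr_ge0.
by rewrite /g big1 // => n _; rewrite passage_lt0 // expr0n.
Qed.

(** By the arithmetic-geometric inequality the products split into two sums of squares, each at most
    [3] uniformly in [N]. *)
Lemma green_le3 N v : green N v <= 3.
Proof.
case: v => x y; rewrite /green /=.
have bound f g : dsum N (fun m k => f m k ^+ 2) <= 3 ->
    dsum N (fun m k => g m k ^+ 2) <= 3 ->
    dsum N (fun m k => f m k * g m k) <= 3.
  move=> hf hg; apply: (@le_trans _ _
    (dsum N (fun m k => (f m k ^+ 2 + g m k ^+ 2) / 2))); last first.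
    rewrite dsumZ dsumD; lra.
  apply: le_dsum => m k; have := sqr_ge0 (f m k - g m k); rewrite !expr2; lra.
have e m k n : passage N (m + n).+1 k = passage N (m + n.+1) (k + 0).
  by rewrite addr0 addnS.
case: y => y; apply: bound.
- under [X in X <= _]eq_bigr do under eq_bigr do rewrite e.
  exact: dsum_passage_sqr_le3.
- under [X in X <= _]eq_bigr do
    under eq_bigr do rewrite -[X in passage N X]addn0.
  exact: dsum_passage_sqr_le3.
- under [X in X <= _]eq_bigr do under eq_bigr do rewrite -[X in X.+1]addn0 e.
  exact: dsum_passage_sqr_le3.
- under [X in X <= _]eq_bigr do under eq_bigr do rewrite -addnS.
  exact: dsum_passage_sqr_le3.
Qed.

End Passage.

(** * Expected visits and return probabilities on a general digraph *)

Section Walk.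
Context {R : realType} {V : countType} (G : digraph V).
Implicit Types (f g : V -> R) (o u v w : V).

Definition walk_op f u : R :=
  (\sum_(v <- fset_set [set v | arc G u v]) f v) / (outdeg G u)%:R.

Lemma mem_out u v : (v \in fset_set [set v | arc G u v]) = arc G u v.
Proof.
rewrite in_fset_set; last exact: arc_fin.
by apply/idP/idP => [/set_mem|/mem_set].
Qed.

Lemma walk_op_le f g u : (forall v, f v <= g v) -> walk_op f u <= walk_op g u.
Proof. by move=> fg; rewrite ler_wpM2r ?invr_ge0 ?ler0n// ler_sum. Qed.

Lemma walk_op_ge0 f u : (forall v, 0 <= f v) -> 0 <= walk_op f u.
Proof. by move=> f0; rewrite divr_ge0 ?ler0n ?sumr_ge0. Qed.

Lemma walk_opD f g u :
  walk_op (fun v => f v + g v) u = walk_op f u + walk_op g u.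
Proof. by rewrite /walk_op big_split mulrDl. Qed.

Lemma walk_opZ c f u : walk_op (fun v => c * f v) u = c * walk_op f u.
Proof. by rewrite /walk_op -mulr_sumr mulrA. Qed.

Lemma walk_op_le_cst f K u : 0 <= K -> (forall v, f v <= K) -> walk_op f u <= K.
Proof.
move=> K0 fK; rewrite /walk_op; have [->|d0] := posnP (outdeg G u).
  by rewrite invr0 mulr0.
rewrite ler_pdivrMr ?ltr0n //; apply: le_trans (ler_sum _ (fun v _ => fK v)) _.
by rewrite big_const_seq count_predT iter_addr_0 mulr_natr.
Qed.

(** Expected number of visits to [o] at times below [N]; [hits o n] below is the probability of a
    visit at some time at most [n], time [0] included. *)
Fixpoint visits o N : V -> R :=
  if N is N'.+1 then fun u => (u == o)%:R + walk_op (visits o N') u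
  else fun=> 0.

Fixpoint hits o n u : R :=
  if u == o then 1 else if n is n'.+1 then walk_op (hits o n') u else 0.

Lemma visits_ge0 o N u : 0 <= visits o N u.
Proof. by elim: N u => //= N IH u; rewrite addr_ge0 ?ler0n ?walk_op_ge0. Qed.

Lemma visits_leS o N u : visits o N u <= visits o N.+1 u.
Proof.
elim: N u => [|N IH] u; first exact: visits_ge0.
by rewrite [leLHS]/= [leRHS]/= lerD2l; exact: walk_op_le.
Qed.

Lemma hits_ge0 o n u : 0 <= hits o n u.
Proof. by elim: n u => [|n IH] u /=; case: ifP => // _; exact: walk_op_ge0. Qed.

(** Once [o] is hit within [n] steps, at least [N] of the [N + n] times remain. *)
Lemma hits_visits o n N u : hits o n u * visits o N o <= visits o (N + n) u.
Proof.
elim: n u => [|n IH] u /=; case: eqP => [->|/eqP uo].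
- by rewrite mul1r addn0.
- by rewrite mul0r visits_ge0.
- rewrite mul1r; elim: n.+1 => [|i IHi]; rewrite ?addn0 // addnS.
  exact: le_trans IHi (visits_leS _ _ _).
- rewrite addnS /= (negbTE uo) add0r mulrC -walk_opZ; apply: walk_op_le => v.
  by rewrite mulrC.
Qed.

Lemma visits_return o n N :
  1 + walk_op (hits o n) o * visits o N o <= visits o (N + n).+1 o.
Proof.
rewrite /= eqxx lerD2l mulrC -walk_opZ; apply: walk_op_le => v.
by rewrite mulrC hits_visits.
Qed.

(** Letting [N] grow in [visits_return], the supremum [S] of the visits satisfies [1 + q * S <= S],
    with [S <= K]. *)
Lemma return_le o K n : (forall N, visits o N o <= K) ->
  walk_op (hits o n) o <= 1 - K^-1.
Proof.
move=> vK; set q := walk_op _ _.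
have q0 : 0 <= q by apply: walk_op_ge0 => v; exact: hits_ge0.
pose E := range (fun N => visits o N o).
have Eub : has_ubound E by exists K => _ [N _ <-].
have E0 : E !=set0 by exists (visits o 0 o), 0%N.
have vS N : visits o N o <= sup E by apply: ub_le_sup => //; exists N.
have SK : sup E <= K by apply: ge_sup => // _ [N _ <-].
have S1 : 1 <= sup E.
  by apply: le_trans (vS 1%N); rewrite /= eqxx lerDl walk_op_ge0.
have qS : q * sup E <= sup E - 1.
  have [->|qn0] := eqVneq q 0; first by rewrite mul0r subr_ge0.
  rewrite mulrC -ler_pdivlMr; last by rewrite lt_neqAle eq_sym qn0.
  apply: ge_sup => // _ [N _ <-].
  rewrite ler_pdivlMr; last by rewrite lt_neqAle eq_sym qn0.
  have := le_trans (visits_return o n N) (vS _); rewrite -/q; lra.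
have K0 : 0 < K by lra.
rewrite -(ler_pM2r K0) mulrBl mulVf ?gt_eqF// mul1r.
(* This allows replacing [sup E] by [K]: [q * (K - sup E) <= K - sup E]. *)
have q1 : q <= 1.
  rewrite -(@ler_pM2r _ (sup E)) ?(lt_le_trans ltr01)//; lra.
nra.
Qed.

(** A visit to [v] is followed by one to [o] with probability the inverse of the out-degree of [v];
    [walk_op] in [H] accounts for the one-step delay. *)
Lemma visits_pred o v K : arc G v o -> (forall N u, visits o N u <= K) ->
  forall N u, visits v N u <= (outdeg G v)%:R * K.
Proof.
move=> vo oK.
have K0 : 0 <= K := oK 0%N o.
have d0 : (0 < outdeg G v)%N.
  by rewrite /outdeg cardfs_gt0; apply/fset0Pn; exists o; rewrite mem_out.
suff H N u : visits v N u <= (outdeg G v)%:R * walk_op (visits o N) u.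
  move=> N u; apply: le_trans (H N u) _.
  by rewrite ler_wpM2l ?ler0n //; exact: walk_op_le_cst.
elim: N u => [|N IH] u /=.
  by rewrite mulr_ge0 ?ler0n // walk_op_ge0.
rewrite walk_opD mulrDr lerD //.
  have [->|_] := eqVneq u v; last first.
    by rewrite mulr_ge0 ?ler0n ?walk_op_ge0 // => w; rewrite ler0n.
  rewrite /walk_op mulrC divfK ?pnatr_eq0 -?lt0n //.
  by rewrite (big_fsetD1 o) /= ?mem_out // eqxx lerDl sumr_ge0.
rewrite -walk_opZ; exact: walk_op_le.
Qed.

End Walk.

(** * Transfer of the bounds to an arbitrary realization of the chain *)

Section Realization.
Context {R : realType} {V : countType} (G : digraph V).
Hypothesis G0 : forall u, (0 < outdeg G u)%N.
Context {d : measure_display} {T : measurableType d} (P : probability T R).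
Variable M : nat -> T -> V.
Hypothesis MP : markov_chain (srw_kernel R G) P M.
Implicit Types (A B C E : set T).

Let pr A : R := fine (P A).

Let prK A : measurable A -> P A = (pr A)%:E.
Proof. by move=> mA; rewrite /pr fineK// fin_num_measure. Qed.

Let pr_ge0 A : 0 <= pr A.
Proof. exact: fine_ge0. Qed.

Let pr_le A B : measurable A -> measurable B -> A `<=` B -> pr A <= pr B.
Proof. by move=> mA mB AB; rewrite -lee_fin -!prK// le_measure ?inE. Qed.

Let prID A B : measurable A -> measurable B ->
  pr A = pr (A `\` B) + pr (A `&` B).
Proof.
move=> mA mB; apply: EFin_inj; rewrite EFinD -!prK //.
- exact: measureDI.
- exact: measurableI.
- exact: measurableD.
Qed.

Let mM n (B : set V) : measurable (M n @^-1` B).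
Proof. by case: MP => + _; exact. Qed.

Let m_history n x : measurable (history M n x).
Proof.
have -> : history M n x =
    \bigcap_(i in [set i | (i <= n)%N]) M i @^-1` [set x i].
  by apply/seteqP; split.
by apply: bigcap_measurableType => i _; exact: mM.
Qed.

Let pr_seq A n (s : seq V) : measurable A -> uniq s ->
  pr (A `&` M n @^-1` [set` s]) = \sum_(v <- s) pr (A `&` M n @^-1` [set v]).
Proof.
move=> mA; elim: s => [_|v s IH /= /andP[vs us]].
  rewrite big_nil (_ : _ `&` _ = set0) /pr ?measure0 //.
  by apply/seteqP; split => // w [].
rewrite big_cons -IH // (@prID _ (M n @^-1` [set v])) //; last first.
  by apply: measurableI => //; exact: mM.
rewrite addrC; congr (pr _ + pr _); apply/seteqP; split => w /=.
- by case=> -[].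
- by case=> Aw ->; rewrite mem_head.
- by case=> -[Aw]; rewrite inE => /orP[/eqP|].
- move=> [Aw ws]; split; first by rewrite inE ws orbT.
  by move=> wv; rewrite wv (negbTE vs) in ws.
Qed.

(** The Markov property at time [m], by splitting along the next position. *)
Let pr_step (h : V -> R) m x E : measurable E ->
  (forall v, pr (history M m x `&` M m.+1 @^-1` [set v] `&` E) <=
     pr (history M m x `&` M m.+1 @^-1` [set v]) * h v) ->
  pr (history M m x `&` E) <= pr (history M m x) * walk_op G h (x m).
Proof.
set C := history M m x => mE hE.
have mC : measurable C by exact: m_history.
(* Conditional probabilities are prescribed only for histories of positive probability. *)
have [C0|C0] := eqVneq (pr C) 0.
  by rewrite C0 mul0r -C0 pr_le //; exact: measurableI.
have Cgt0 : 0 < pr C by rewrite lt_neqAle eq_sym C0 pr_ge0.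
have trans v : pr (C `&` M m.+1 @^-1` [set v]) = pr C * srw_kernel R G (x m) v.
  case: MP => _ /(_ m x v); rewrite -/C prK // lte_fin => /(_ Cgt0) <-.
  by rewrite /cond_prob -/(pr C) mulrC divfK // setIC.
pose s := fset_set [set v | arc G (x m) v].
pose S := M m.+1 @^-1` [set` s].
have us : uniq s by exact: fset_uniq.
have mS : measurable S by exact: mM.
have trs v : v \in s -> srw_kernel R G (x m) v = (outdeg G (x m))%:R^-1.
  by rewrite mem_out /srw_kernel => ->.
(* As out-degrees are positive, the kernel has total mass [1] on the out-neighbours, so the next
   position is almost surely one of them. *)
have out0 : pr (C `\` S) = 0.
  have := prID mC mS; rewrite pr_seq //.
  under eq_bigr do rewrite trans.
  rewrite -mulr_sumr (eq_big_seq _ trs) big_const_seq count_predT iter_addr_0.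
  rewrite -[_^-1 *+ _]mulr_natr -[size s]/(outdeg G (x m)).
  rewrite mulVf ?pnatr_eq0 -?lt0n ?G0 // mulr1.
  by move=> /eqP; rewrite -subr_eq subrr eq_sym => /eqP.
have mCE : measurable (C `&` E) by exact: measurableI.
rewrite (prID mCE mS).
have -> : pr (C `&` E `\` S) = 0.
  apply/le_anti; rewrite pr_ge0 andbT -out0 pr_le //; try exact: measurableD.
  by move=> w [[? ?] ?]; split.
rewrite add0r pr_seq // /walk_op mulrA mulr_sumr mulr_suml.
rewrite big_seq [leRHS]big_seq; apply: ler_sum => v vs.
have := hE v; rewrite trans trs //.
by rewrite setIAC mulrAC.
Qed.

Let visit o m n : set T := [set w | exists2 i, (m <= i <= m + n)%N & M i w = o].

Let m_visit o m n : measurable (visit o m n).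
Proof.
have -> : visit o m n =
    \bigcup_(i in [set i | (m <= i <= m + n)%N]) M i @^-1` [set o].
  by apply/seteqP; split => w [i]; exists i.
by apply: bigcup_measurable => i _; exact: mM.
Qed.

Let historyS m x v : history M m x `&` M m.+1 @^-1` [set v] =
  history M m.+1 (fun i => if i == m.+1 then v else x i).
Proof.
apply/seteqP; split => w /=.
  move=> [hw Mv] i; rewrite leq_eqVlt ltnS.
  by case: eqP => [->|_ /= im]//; exact: hw.
move=> hw; split; last by rewrite hw // eqxx.
by move=> i im; rewrite hw ?ltn_eqF ?ltnS // ltnW.
Qed.

(** Induction on [n] for all histories at once: off [o], the visit occurs from time [m.+1] on, and
    [pr_step] applies to the extended histories. *)
Lemma pr_visit o n m x :
  pr (history M m x `&` visit o m n) <= pr (history M m x) * hits G o n (x m).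
Proof.
elim: n m x => [|n IH] m x /=; case: eqP => xo.
- by rewrite mulr1 pr_le //; exact: measurableI.
- rewrite mulr0 (_ : _ `&` _ = set0) /pr ?measure0 //.
  apply/seteqP; split => // w [hw [i]]; rewrite addn0 => /anti_leq <- Mo.
  by apply: xo; rewrite -(hw m) // Mo.
- by rewrite mulr1 pr_le //; exact: measurableI.
- have -> : history M m x `&` visit o m n.+1 =
      history M m x `&` visit o m.+1 n.
    apply/seteqP.
    split => w [hw [i /andP[mi im] Mo]]; split=> //; exists i => //.
      rewrite addSnnS im andbT ltn_neqAle mi andbT.
      by apply/eqP => mE; apply: xo; rewrite -(hw m) // mE.
    by rewrite (ltnW mi) -addSnnS.
  apply: pr_step; first exact: m_visit.
  by move=> v; rewrite historyS; apply: le_trans (IH _ _) _; rewrite eqxx.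
Qed.

(** Continuity from below: a return is the increasing union of the returns by time [n.+1]. *)
Lemma pr_returns o q : P (M 0 @^-1` [set o]) = 1%E ->
  (forall n, walk_op G (hits G o n) o <= q) -> (P (returns M o) <= q%:E)%E.
Proof.
move=> P1 hq.
have -> : returns M o = \bigcup_n visit o 1 n.
  apply/seteqP; split => w; first
    by move=> [n n0 Mo]; exists n => //; exists n => //; rewrite n0 leq_addl.
  by move=> [n _ [i /andP[i0 _] Mo]]; exists i.
have := @nondecreasing_cvg_mu _ _ _ P (visit o 1) (m_visit o 1).
move=> /(_ (bigcup_measurable (fun n _ => m_visit o 1 n))) cvP.
apply: cvge_le (cvP _); last first.
  move=> n n' nn'; apply/subsetPset => w [i /andP[i0 ile] Mo].
  by exists i => //; rewrite i0 (leq_trans ile) ?leq_add2l.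
apply: nearW => n /=; rewrite prK // lee_fin.
pose C := history M 0 (fun=> o).
have CE : C = M 0%N @^-1` [set o].
  apply/seteqP; split => w /=; first exact.
  by move=> Mo i; rewrite leqn0 => /eqP ->.
have C1 : pr C = 1 by rewrite /pr CE P1.
have mC : measurable C by exact: m_history.
have T0 : pr (setT `\` C) = 0.
  have := prID measurableT mC; rewrite setTI C1 {1}/pr probability_setT /=; lra.
rewrite (prID (m_visit o 1 n) mC).
have -> : pr (visit o 1 n `\` C) = 0.
  apply/le_anti; rewrite pr_ge0 andbT -T0 pr_le //; try exact: measurableD.
  exact: setSD.
rewrite add0r setIC; apply: le_trans (hq n).
rewrite -[leRHS]mul1r -C1; apply: pr_step => // v.
by rewrite historyS; apply: le_trans (pr_visit _ _ _ _) _; rewrite eqxx.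
Qed.

End Realization.

Lemma transient_of_visits (R : realType) (V : countType) (G : digraph V) :
  (forall u, (0 < outdeg G u)%N) ->
  (forall u, exists K : R, forall N, visits G u N u <= K) ->
  transient (srw_kernel R G).
Proof.
move=> G0 hK u d T P M MP Mu; have [K uK] := hK u.
apply: le_lt_trans (pr_returns G0 MP Mu (fun n => return_le n uK)) _.
rewrite lte_fin ltrBlDr ltrDl invr_gt0.
(* [K >= 1], since the visit at time [0] is counted. *)
apply: lt_le_trans ltr01 (le_trans _ (uK 1%N)).
by rewrite /= eqxx lerDl walk_op_ge0.
Qed.

(** * Bounded visits on the half-plane lattice *)

Section HalfPlane.
Context {R : realType}.

Lemma walk_op_half_plane (f : int * int -> R) x y :
  walk_op half_plane f (x, y) =
    (f (x, y + 1) + f (x, y - 1) + f (x + eps y, y)) / 3.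
Proof.
rewrite /walk_op outdeg_half_plane /= half_plane_arcE set_fsetK; congr (_ / _).
rewrite -fsetUA !big_fsetU1 /= ?big_seq_fset1 ?addrA // !inE !xpair_eqE.
- by rewrite /eps; case: ifP; lia.
- by lia.
Qed.

Lemma green_super N x y :
  walk_op half_plane (green R N) (x, y) + ((x, y) == (0, 0))%:R / 3
    <= green R N.+1 (x, y).
Proof.
rewrite walk_op_half_plane -mulrDl /eps; case: y => y.
  by rewrite le0z_nat green_up.
by rewrite xpair_eqE andbF addr0 /= green_down.
Qed.

(** [3 * green], translated along the axis, is a supersolution of the recursion of [visits]; the
    factor [3] gives the source unit mass. *)
Lemma visits_axis (x0 : int) N v :
  visits half_plane (x0, 0) N v <= 3 * green R N (v.1 - x0, v.2).
Proof.
elim: N v => [|N IH] [x y]; first by rewrite mulr_ge0 ?green_ge0.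
have /(ler_wpM2l (ler0n R 3)) := green_super N (x - x0) y.
apply: le_trans; rewrite mulrDr [3 * (_ / 3)]mulrC divfK // addrC /=.
rewrite !xpair_eqE subr_eq0 lerD2l.
apply: le_trans (walk_op_le _ _ IH) _.
by rewrite walk_opZ !walk_op_half_plane /= [x + _ - _]addrAC.
Qed.

Lemma visits_bounded (u : int * int) :
  exists K : R, forall N v, visits half_plane u N v <= K.
Proof.
have pred v o : arc half_plane v o ->
    (exists K : R, forall N w, visits half_plane o N w <= K) ->
    exists K : R, forall N w, visits half_plane v N w <= K.
  move=> vo [K oK]; exists ((outdeg half_plane v)%:R * K).
  exact: (visits_pred vo oK).
case: u => x y.
have axis : exists K : R, forall N v, visits half_plane (x, 0) N v <= K.
  (* The factor [3] of [visits_axis] times the bound [3] of [green_le3]. *)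
  exists 9 => N v; apply: le_trans (visits_axis _ _ _) _.
  have := green_le3 R N (v.1 - x, v.2); lra.
(* Off the axis, each vertex has an arc to the vertex one level closer in its column. *)
case: y => y.
  elim: y => // y; apply: pred; rewrite /= /half_plane_arc /= eqxx /=.
  by apply/orP; left; apply/orP; right; apply/eqP; lia.
elim: y => [|y].
  by move: axis; apply: pred; rewrite /= /half_plane_arc /= eqxx.
apply: pred; rewrite /= /half_plane_arc /= eqxx /=.
by apply/orP; left; apply/orP; left; apply/eqP; lia.
Qed.

End HalfPlane.

Theorem theorem2p9 (R : realType) : transient (srw_kernel R half_plane).
Proof.
apply: transient_of_visits => u; first by rewrite outdeg_half_plane.
by have [K uK] := @visits_bounded R u; exists K => N; exact: uK.
Qed.
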